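(* There are $2^{\aleph_0}$ ages of bichains which are minimal prime, and there are $2^{\aleph_0}$ ages of permutation orders which are minimal prime.
   Context: A bichain is a structure $(V,(\le',\le''))$ where $\le'$ and $\le''$ are two linear orders on $V$. A permutation order is a poset of the form $(V,\le'\cap\le'')$, the intersection order of a bichain $(V,(\le',\le''))$. For structures $\mathcal R,\mathcal R'$ of the same type, $\mathcal R$ embeds in $\mathcal R'$ if it is isomorphic to an induced substructure of $\mathcal R'$. $\mathrm{Age}(\mathcal R)$ is the class of finite structures, up to isomorphism, that embed in $\mathcal R$. A class of finite structures is hereditary if it is closed under embedded structures. A module of $\mathcal R=(V,(\rho_i)_{i\in I})$ (each $\rho_i$ binary) is a subset $A\subseteq V$ such that for all $a,a'\in A$, $x\in V\setminus A$, $i\in I$: $(x\rho_i a\Leftrightarrow x\rho_i a')$ and $(a\rho_i x\Leftrightarrow a'\rho_i x)$. $\mathcal R$ is prime if its only modules are $\emptyset$, the singletons and $V$. A hereditary class is minimal prime if it contains infinitely many prime structures (up to isomorphism), while every proper hereditary subclass contains only finitely many. *)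

(* Defs.v *)
From mathcomp Require Import all_boot.
From mathcomp Require Import boolp classical_sets functions cardinality wochoice.

Set Implicit Arguments.
Unset Strict Implicit.
Unset Printing Implicit Defensive.

Local Open Scope classical_set_scope.

Definition structure (I V : Type) := I -> rel V.

Definition isomorphic (I V W : Type) (R : structure I V) (S : structure I W) :=
  exists2 f : V -> W, bijective f & forall i x y, S i (f x) (f y) = R i x y.

Definition induced (I V : Type) (R : structure I V) (A : set V) :
    structure I (set_type A) :=
  fun i x y => R i (val x) (val y).
Arguments induced {I V} R A.

Definition embeds (I V W : Type) (R : structure I V) (S : structure I W) :=
  exists A : set W, isomorphic R (induced S A).

Definition module (I V : Type) (R : structure I V) (A : set V) :=
  forall a a' x i, A a -> A a' -> ~ A x ->
    (R i x a <-> R i x a') /\ (R i a x <-> R i a' x).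

Definition prime_structure (I V : Type) (R : structure I V) :=
  forall A : set V, module R A ->
    [\/ A = set0, exists x, A = [set x] | A = [set: V]].

(* Every finite structure is isomorphic to one on some ['I_n], so a class of
   finite structures closed under isomorphism is given by its members of this
   form. *)
Record fin_structure (I : Type) := FinStructure {
  fin_size : nat;
  fin_rel :> structure I 'I_fin_size
}.

Definition iso_type (I : Type) (R : fin_structure I) : set (fin_structure I) :=
  [set S : fin_structure I | isomorphic R S].

Definition age (I V : Type) (R : structure I V) : set (fin_structure I) :=
  [set S : fin_structure I | embeds S R].

(* Closure under embedded structures includes closure under isomorphism. *)
Definition hereditary (I : Type) (C : set (fin_structure I)) :=
  forall R S : fin_structure I, C S -> embeds R S -> C R.

Definition prime_types (I : Type) (C : set (fin_structure I)) :
    set (set (fin_structure I)) :=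
  [set iso_type R | R in
     [set R : fin_structure I | C R /\ prime_structure R]].

Definition minimal_prime (I : Type) (C : set (fin_structure I)) :=
  [/\ hereditary C,
      infinite_set (prime_types C) &
      forall D : set (fin_structure I),
        hereditary D -> D `<` C -> finite_set (prime_types D)].

(* The two linear orders are [B false] and [B true]. *)
Definition bichain (V : Type) (B : structure bool V) :=
  forall i, total_order (B i).

Definition intersection_order (V : Type) (B : structure bool V) :
    structure unit V :=
  fun _ x y => B false x y && B true x y.
Arguments intersection_order {V} B.

Definition permutation_order (V : Type) (P : structure unit V) :=
  exists2 B : structure bool V, bichain B & P = intersection_order B.

Definition bichain_ages : set (set (fin_structure bool)) :=
  [set C | exists (V : Type) (B : structure bool V), bichain B /\ C = age B].

Definition permutation_order_ages : set (set (fin_structure unit)) :=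
  [set C | exists (V : Type) (P : structure unit V),
     permutation_order P /\ C = age P].

(* Main.v *)
Require Import Defs.
From mathcomp Require Import all_boot.
From mathcomp Require Import boolp classical_sets functions cardinality wochoice.
From mathcomp Require Import zify.

(** There are only countably many finite structures with finitely many binary
    relations, so there are at most continuum many classes of them.  The point
    is to exhibit continuum many minimal prime ages.

    To a word [c : nat -> bool] is attached a sequence of points of the plane:
    [2k] lies above or below all earlier points, according to [c k], and
    [2k + 1] lies to the right of all earlier points; in the other coordinate
    each point is placed just inside its predecessor, which it thereby
    separates from all the other earlier points.  The two coordinate orders
    form the bichain [pins c], and [pin_order c] is the intersection order.  In
    both structures the relation between [j] and [i] is the same for all
    [i < j - 1], and in [pin_order c] it is different for [i = j - 1].

    If a set of points skips [g], its elements below [g] therefore form a module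
    of it.  Hence a prime induced substructure is an interval, up to one extra
    least point.  When [c] is uniformly recurrent, every finite substructure
    occurs in all long intervals, hence in all large primes; so a proper
    hereditary subclass of the age contains only boundedly large primes
    ([minimal_prime_age]).  Conversely an initial interval is prime as soon as
    it stops where [c] changes value ([initial_pin_order_prime]).

    The words used are of the form [c k = f v], where [v] is the 2-adic
    valuation of [k + 1]; they repeat along all multiples of a large power of
    2, and [f] can be recovered from the factors of [c].  The factors are in
    turn recovered from the age: an embedding of a prime initial interval of
    [pin_order c] in [pin_order c'] is a translation outside a bounded number of
    points ([word_shift]).  So different words give different ages of orders.
    For bichains nothing more has to be computed: primality passes from the
    intersection order to the bichain, and the age of a bichain determines the
    age of its intersection order. *)

Set Implicit Arguments.
Unset Strict Implicit.
Unset Printing Implicit Defensive.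

Local Open Scope classical_set_scope.
Local Open Scope card_scope.

(** * Embeddings, ages and prime members *)

Section Embeddings.
Variable I : Type.

Definition embedding (V W : Type) (R : structure I V) (S : structure I W)
    (f : V -> W) :=
  injective f /\ forall i x y, S i (f x) (f y) = R i x y.

Lemma embedsP (V W : Type) (R : structure I V) (S : structure I W) :
  embeds R S <-> exists f, embedding R S f.
Proof.
split=> [[A [f /bij_inj f_inj f_rel]]|[f [f_inj f_rel]]].
  exists (val \o f); split=> [|i x y]; first exact: inj_comp val_inj f_inj.
  exact: f_rel.
pose g x : set_type (range f) := SigSub (mem_set (imageT f x)).
exists (range f), g => [|i x y]; last exact: f_rel.
have g_surj (y : set_type (range f)) : {x | f x = val y}.
  by apply: cid; have [x _ fx] := set_mem (valP y); exists x.
exists (fun y => sval (g_surj y)) => [x|y].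
  by apply: f_inj; case: (g_surj (g x)).
by apply: val_inj => /=; case: (g_surj y).
Qed.

Lemma embeds_trans (U V W : Type) (R : structure I U) (S : structure I V)
    (T : structure I W) : embeds R S -> embeds S T -> embeds R T.
Proof.
move=> /embedsP[f [f_inj f_rel]] /embedsP[g [g_inj g_rel]].
apply/embedsP; exists (g \o f); split=> [|i x y]; first exact: inj_comp.
by rewrite /= g_rel f_rel.
Qed.

Lemma hereditary_age (V : Type) (R : structure I V) : hereditary (age R).
Proof. by move=> S T TR ST; exact: embeds_trans ST TR. Qed.

(** The number of points is the only isomorphism invariant that matters for
    counting prime members. *)
Lemma iso_type_size (R S : fin_structure I) :
  iso_type R S -> fin_size S = fin_size R.
Proof. by case=> f /bij_eq_card; rewrite !card_ord. Qed.

Definition initial (R : structure I nat) n : fin_structure I :=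
  FinStructure (fun i (x y : 'I_n) => R i x y).

Lemma age_initial (R : structure I nat) n : age R (initial R n).
Proof.
by apply/embedsP; exists (@nat_of_ord n); split=> //; exact: ord_inj.
Qed.

Lemma iso_type_self (R : fin_structure I) : iso_type R R.
Proof. by exists id => //; exists id. Qed.

Lemma infinite_prime_types (C : set (fin_structure I)) :
  (forall N, exists R : fin_structure I,
     [/\ C R, prime_structure R & N <= fin_size R]) ->
  infinite_set (prime_types C).
Proof.
move=> unbounded fin_types.
have [size_of size_of_iso] : exists size_of, forall R : fin_structure I,
    size_of (iso_type R) = fin_size R.
  suff /choice[size_of sizeP] : forall X, exists n, forall R : fin_structure I,
      X = iso_type R -> n = fin_size R by exists size_of => R; exact: sizeP.
  move=> X; have [[S XS]|noX] := pselect (exists S : fin_structure I, X = iso_type S).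
    exists (fin_size S) => R; rewrite XS => SR.
    by apply: iso_type_size; rewrite -SR; exact: iso_type_self.
  by exists 0 => R XR; case: noX; exists R.
have /finite_seqP[s sE] := finite_image size_of fin_types.
have [R [CR primeR]] := unbounded (\max_(n <- s) n).+1.
have : [set` s] (fin_size R).
  by rewrite -sE -size_of_iso; exists (iso_type R) => //; exists R.
move=> /= /(@leq_bigmax_seq _ _ xpredT id)/(_ isT) /=; lia.
Qed.

Lemma prime_types_initial (R : structure I nat) :
  (forall N, exists2 n, N <= n & prime_structure (initial R n)) ->
  infinite_set (prime_types (age R)).
Proof.
move=> prime_initial; apply: infinite_prime_types => N.
have [n leNn prime_n] := prime_initial N.
by exists (initial R n); split=> //; exact: age_initial.
Qed.

End Embeddings.

(** A module of a bichain is a module of its intersection order, since the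
    latter is defined from the two orders pointwise. *)
Lemma prime_of_intersection (V : Type) (B : structure bool V) :
  prime_structure (intersection_order B) -> prime_structure B.
Proof.
move=> primeP A modA; apply: primeP => a a' x u Aa Aa' Ax.
have sees i : B i x a = B i x a' /\ B i a x = B i a' x.
  have [l r] := modA a a' x i Aa Aa' Ax.
  by split; apply/idP/idP; [apply l|apply l|apply r|apply r].
rewrite /intersection_order.
by have [-> ->] := sees true; have [-> ->] := sees false.
Qed.

(** A finite suborder of the intersection order carries the two linear orders
    induced by the bichain; it can be moved together with them. *)
Lemma age_intersection_order (V W : Type) (B : structure bool V)
    (C : structure bool W) :
  age B `<=` age C -> age (intersection_order B) `<=` age (intersection_order C).
Proof.
move=> BC S /embedsP[f [f_inj f_rel]].
pose T := FinStructure (fun i x y => B i (f x) (f y)).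
have /embedsP[g [g_inj g_rel]] : age C T.
  by apply: BC; apply/embedsP; exists f.
apply/embedsP; exists g; split=> // u x y.
by rewrite -f_rel /intersection_order !g_rel.
Qed.

(** * Counting classes of finite structures *)

Section FiniteSignature.
Variable I : finType.

Definition fin_code := {n : nat & {ffun I * 'I_n * 'I_n -> bool}}.

Definition fin_decode (t : fin_code) : fin_structure I :=
  FinStructure (fun i x y => tagged t (i, x, y)).

Definition fin_encode (S : fin_structure I) : fin_code :=
  Tagged (fun n => {ffun I * 'I_n * 'I_n -> bool})
    [ffun p => @fin_rel I S p.1.1 p.1.2 p.2].

Lemma fin_encodeK : cancel fin_encode fin_decode.
Proof.
case=> n r; rewrite /fin_decode /fin_encode /=; congr FinStructure.
by apply/funext => i; apply/funext => x; apply/funext => y; rewrite ffunE.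
Qed.

Lemma card_fin_classes_le : [set: set (fin_structure I)] #<= [set: nat -> bool].
Proof.
pose code (X : set (fin_structure I)) n :=
  if unpickle n is Some t then `[< X (fin_decode t) >] else false.
apply/pcard_injP; exists code => X Y _ _ XY; apply/seteqP.
have codeE Z S : code Z (pickle (fin_encode S)) = `[< Z S >].
  by rewrite /code pickleK fin_encodeK.
by split=> S ZS; apply/asboolP; rewrite -codeE (XY, =^~ XY) codeE; apply/asboolP.
Qed.

Lemma finite_bounded_structures N :
  finite_set [set S : fin_structure I | fin_size S < N].
Proof.
pose decode (t : {n : 'I_N & {ffun I * 'I_n * 'I_n -> bool}}) :=
  FinStructure (fun i x y => tagged t (i, x, y)).
apply: (@sub_finite_set _ _ (range decode)); last exact/finite_image/finite_finset.
case=> n r /= ltnN.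
exists (Tagged (fun n : 'I_N => {ffun I * 'I_n * 'I_n -> bool})
  (i := Ordinal ltnN) [ffun p => r p.1.1 p.1.2 p.2]) => //.
rewrite /decode /=; congr FinStructure.
by apply/funext => i; apply/funext => x; apply/funext => y; rewrite ffunE.
Qed.

Lemma finite_prime_types (D : set (fin_structure I)) N :
  (forall R : fin_structure I, D R -> prime_structure R -> fin_size R < N) ->
  finite_set (prime_types D).
Proof.
move=> small; apply: finite_image; apply: sub_finite_set (finite_bounded_structures N).
by move=> R [DR primeR]; exact: small.
Qed.

End FiniteSignature.

(** * Structures in which each point sees the remote past uniformly *)

Section UniformPast.
Variable I : finType.

(** The immediate predecessor of [j] is left out: it is the only point whose
    relation to [j] may be different. *)
Definition uniform_below (R : structure I nat) :=
  forall i a b j, a.+1 < j -> b.+1 < j ->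
    R i j a = R i j b /\ R i a j = R i b j.

(** The analogue for structures of the uniform recurrence of words. *)
Definition recurrent (R : structure I nat) :=
  forall m, exists L, forall p, exists2 s, p <= s <= p + L &
    forall i x y, x <= m -> y <= m -> R i (s + x) (s + y) = R i x y.

(** If the image of a prime structure skips [g], no point of the image above [g]
    is the immediate successor of one below [g], so the points below [g] form a
    module.  If there are at least two of them, it must be everything. *)
Lemma prime_no_gap (V : Type) (S : structure I V) (R : structure I nat) f g x y z :
  uniform_below R -> embedding S R f -> prime_structure S ->
  (forall v, f v <> g) -> x <> y -> f x < g -> f y < g -> f z < g.
Proof.
move=> unif [f_inj f_rel] primeS no_g xy fx fy.
have mod_below : module S [set v | f v < g].
  move=> a b w i /= fa fb /negP; rewrite -leqNgt leq_eqVlt => /predU1P[/esym/no_g//|fw].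
  have [] := unif i (f a) (f b) (f w); [lia|lia|].
  by rewrite !f_rel => -> ->.
have [below0|[v belowE]|belowT] := primeS _ mod_below.
- by have : [set v | f v < g] x by []; rewrite below0.
- have : [set v | f v < g] x by []. have : [set v | f v < g] y by [].
  by rewrite belowE /= => yv xv; case: xy; rewrite xv yv.
- by have : [set v | f v < g] z by rewrite belowT.
Qed.

(** By the previous lemma at most one point can lie below a gap, so the image is
    an interval ending at its maximum [e], plus possibly one smaller point. *)
Lemma prime_interval n (S : structure I 'I_n) (R : structure I nat) f e :
  uniform_below R -> embedding S R f -> prime_structure S ->
  (forall x, f x <= e) -> (exists x, f x = e) ->
  forall i, i.+1 < n -> exists x, f x + i = e.
Proof.
move=> unif emb primeS f_le [top f_top] i lt_in.
have [] := pselect (exists x, f x + i = e) => // no_i; exfalso.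
have f_inj := emb.1.
have i_gt0 : 0 < i.
  by case: i lt_in no_i => // _ []; exists top; rewrite addn0.
pose above := [set x | e < f x + i]%SET.
have card_above : #|above| <= i.
  rewrite cardE -(size_map f) -(size_iota (e.+1 - i) i).
  apply: uniq_leq_size; first by rewrite map_inj_uniq ?enum_uniq.
  move=> _ /mapP[x + ->]; rewrite mem_enum inE mem_iota => fx.
  by have := f_le x; lia.
(* A value [e - i] that is not attained would leave two points below it. *)
have : 1 < #|(~: above)%SET| by rewrite cardsCs finset.setCK card_ord; lia.
move=> /card_gt1P[x [y [xb yb xy]]].
have le_ie : i < e.
  move: xb yb xy; rewrite !inE -!leqNgt => fx fy xy.
  have xi : f x + i <> e by move=> fxi; apply: no_i; exists x.
  by lia.
have below v : v \in (~: above)%SET -> f v < e - i.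
  rewrite !inE -leqNgt => fv.
  have vi : f v + i <> e by move=> fvi; apply: no_i; exists v.
  by lia.
have no_gap v : f v <> e - i.
  by move=> fv; apply: no_i; exists v; lia.
have := prime_no_gap top unif emb primeS no_gap (elimN eqP xy) (below x xb) (below y yb).
by rewrite f_top; lia.
Qed.

Lemma exists_max n (f : 'I_n.+1 -> nat) :
  exists2 e, forall x, f x <= e & exists x, f x = e.
Proof.
have [x _ f_max] := @arg_maxnP _ ord0 predT f isT.
by exists (f x) => [y|]; [exact: f_max | exists x].
Qed.

(** A proper hereditary subclass omits some finite [S] in the age, and [S] lives
    in an initial interval.  A large prime member of the age contains a long
    interval, hence by recurrence a translate of that initial interval, hence
    [S]; so the primes of the subclass are small. *)
Lemma minimal_prime_age (R : structure I nat) :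
  uniform_below R -> recurrent R ->
  (forall N, exists2 n, N <= n & prime_structure (initial R n)) ->
  minimal_prime (age R).
Proof.
move=> unif rec prime_initial; split; [exact: hereditary_age|exact: prime_types_initial|].
move=> D herD [subD]; rewrite -existsNE => -[S /not_implyP[/embedsP[f [f_inj f_rel]] notDS]].
have [m f_le] : exists m, forall x, f x <= m.
  exists (\max_x f x) => x; exact: leq_bigmax.
have [L recL] := rec m.
apply: (@finite_prime_types _ _ (L + m + 3)) => T DT primeT.
rewrite ltnNge; apply/negP => large; apply: notDS; apply: (herD _ T) => //.
have /embedsP := subD _ DT.
case: T DT primeT large => -[|n] T DT /= primeT large [h emb]; first by lia.
have [e h_le h_top] := exists_max h.
have mem_h := prime_interval unif emb primeT h_le h_top.
have [x hx] : exists x, h x + (L + m) = e by apply: mem_h; lia.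
have [s s_int s_rel] := recL (e - (L + m)).
have pre u : exists v, h v = s + f u.
  have := f_le u => fu; have [v hv] : exists v, h v + (e - (s + f u)) = e by apply: mem_h; lia.
  by exists v; lia.
have [k hk] := choice pre.
apply/embedsP; exists k; split=> [u v kuv|i u v].
  by apply: f_inj; apply: (@addnI s); rewrite -!hk kuv.
by rewrite -emb.2 !hk s_rel // f_rel.
Qed.

End UniformPast.

(** * Pin sequences *)

Section PinSequences.
Implicit Types c : nat -> bool.

(** The keys are absolute values of the coordinates of the points.  An even point
    [x] has horizontal coordinate just below that of the odd point [x - 1], and
    an odd point [x] has vertical coordinate just closer to 0 than that of the
    even point [x - 1].  Horizontal coordinates are nonnegative; the sign of the
    vertical coordinate of [x] is given by [c x./2]. *)
Definition horizontal_key j := if odd j then j.+2 else j.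
Definition vertical_key j := if odd j then j else j.+2.

Definition vertical_le c x y :=
  if c x./2 then c y./2 && (vertical_key x <= vertical_key y)
  else c y./2 || (vertical_key y <= vertical_key x).

Definition pins c : structure bool nat := fun i x y =>
  if i then horizontal_key x <= horizontal_key y else vertical_le c x y.

Lemma bichain_pins c : bichain (pins c).
Proof.
rewrite /bichain /pins => -[]; (split; [split; [split|]|]).
- by move=> x.
- by move=> y x z; exact: leq_trans.
- move=> x y; rewrite /horizontal_key.
  by case: ifPn => ox; case: ifPn => oy; lia.
- by move=> x y; exact: leq_total.
- by move=> x; rewrite /vertical_le leqnn orbT andbT; case: ifP.
- move=> y x z; rewrite /vertical_le.
  by case: (c x./2); case: (c y./2); case: (c z./2); rewrite //=; lia.
- move=> x y; rewrite /vertical_le /vertical_key.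
  by case: (c x./2); case: (c y./2); rewrite //=; case: ifPn => ox; case: ifPn => oy; lia.
- move=> x y; rewrite /vertical_le.
  by case: (c x./2); case: (c y./2); rewrite //=; lia.
Qed.

Definition pin_order c := intersection_order (pins c).

Lemma permutation_order_pin_order c : permutation_order (pin_order c).
Proof. by exists (pins c); first exact: bichain_pins. Qed.

Lemma pins_far c i j : i.+1 < j ->
  [/\ pins c true i j, pins c true j i = false,
      pins c false i j = c j./2 & pins c false j i = ~~ c j./2].
Proof.
move=> ij; rewrite /pins /vertical_le /horizontal_key /vertical_key.
by split; [..|case: (c i./2); case: (c j./2)|case: (c i./2); case: (c j./2)];
  rewrite //=; case: ifPn => oi; case: ifPn => oj; lia.
Qed.

Lemma pin_order_far c u i j : i.+1 < j ->
  pin_order c u i j = c j./2 /\ pin_order c u j i = false.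
Proof.
move=> /(pins_far c)[h1 h2 v1 v2].
by rewrite /pin_order /intersection_order h1 h2 v1 v2 andbT andbF.
Qed.

Lemma pin_order_next c u j :
  pin_order c u j j.+1 = odd j.+1 && ~~ c j.+1./2 /\
  pin_order c u j.+1 j = ~~ odd j.+1 && ~~ c j.+1./2.
Proof.
rewrite /pin_order /intersection_order /pins /vertical_le /horizontal_key.
rewrite /vertical_key /=; case: (boolP (odd j)) => oj /=.
  by case: (c j./2); case: (c (uphalf j)); rewrite //=; lia.
have -> : uphalf j = j./2 by lia.
by case: (c j./2); rewrite //=; lia.
Qed.

Lemma uniform_below_pins c : uniform_below (pins c).
Proof.
move=> i a b j /(pins_far c)[ha1 ha2 va1 va2] /(pins_far c)[hb1 hb2 vb1 vb2].
by case: i; rewrite ?ha1 ?ha2 ?va1 ?va2 ?hb1 ?hb2 ?vb1 ?vb2.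
Qed.

Lemma uniform_below_pin_order c : uniform_below (pin_order c).
Proof.
by move=> u a b j /(pin_order_far c u)[-> ->] /(pin_order_far c u)[-> ->].
Qed.

(** If the letter of [j + 1] is [true], then [j + 1] is comparable to [i] and
    not to [j]; if it is [false], it is comparable to [j] and not to [i]. *)
Lemma pin_splits c u i j : i < j ->
  ~ (pin_order c u i j.+1 = pin_order c u j j.+1 /\
     pin_order c u j.+1 i = pin_order c u j.+1 j).
Proof.
move=> ij; have [-> ->] := @pin_order_far c u i j.+1 ij.
by have [-> ->] := pin_order_next c u j; case: (c _); case: (odd _) => -[].
Qed.

(** An odd translation would exchange the roles of the two coordinates. *)
Lemma pins_shift c s x y :
  ~~ odd s -> c (s + x)./2 = c x./2 -> c (s + y)./2 = c y./2 ->
  forall i, pins c i (s + x) (s + y) = pins c i x y.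
Proof.
move=> /negbTE s_even cx cy.
have [hK vK] : (forall z, horizontal_key (s + z) = s + horizontal_key z) /\
    (forall z, vertical_key (s + z) = s + vertical_key z).
  by split=> z; rewrite /horizontal_key /vertical_key oddD s_even /=; case: ifP => _; rewrite ?addnS.
by case; rewrite /= /vertical_le ?cx ?cy ?hK ?vK !leq_add2l.
Qed.

(** Let a module contain two points of [[0, n]].  As [pin_splits] shows, it then
    contains the successor of each of its points, except perhaps the least one;
    so it contains [n].  If it also contains [n - 1], a point outside it
    and below [n - 2] would have the same relation to [n - 1] and to [n], which
    the change of letter at [n] forbids; so it contains everything.  If it does
    not contain [n - 1], it is [{i, n}], and the points [n - 1], [n - 2],
    [i - 1] and [i - 2] outside it cannot all relate equally to [i] and [n]. *)
Lemma initial_pin_order_prime c n :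
  4 < n -> ~~ odd n -> c n./2 != c n./2.-1 ->
  prime_structure (initial (pin_order c) n.+1).
Proof.
move=> n_gt4 n_even turn A modA.
have [noA|/existsNP[x0 /contrapT Ax0]] := pselect (forall x, ~ A x).
  by constructor 1; apply/seteqP; split.
have [oneA|/existsNP[y0 /not_implyP[Ay0 y0x0]]] := pselect (forall x, A x -> x = x0).
  by constructor 2; exists x0; apply/seteqP; split=> [x /oneA|_ ->].
constructor 3; pose M k := exists2 x : 'I_n.+1, A x & val x = k.
have sees w a b : w <= n -> ~ M w -> M a -> M b ->
    pin_order c tt w a = pin_order c tt w b /\
    pin_order c tt a w = pin_order c tt b w.
  move=> le_wn notMw [a' Aa <-] [b' Ab <-].
  have notAw : ~ A (inord w) by move=> Aw; apply: notMw; exists (inord w); rewrite /= ?inordK.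
  have [/= l r] := modA _ _ _ tt Aa Ab notAw.
  move: l r; rewrite !inordK // => l r.
  by split; apply/idP/idP; [apply l|apply l|apply r|apply r].
suff allM k : k <= n -> M k.
  by apply/seteqP; split=> // x _; have [y Ay /val_inj <-] := allM x (leq_ord x).
have up i j : M i -> M j -> i < j -> j < n -> M j.+1.
  move=> Mi Mj ij jn; apply: contrapT => notM.
  have [r l] := sees _ _ _ jn notM Mi Mj.
  by apply: (pin_splits (c := c) (u := tt) ij).
have [i [j [Mi Mj ij jn]]] : exists i j, [/\ M i, M j, i < j & j <= n].
  have Mx : M x0 by exists x0. have My : M y0 by exists y0.
  have : val x0 <> val y0 by move=> /val_inj/esym.
  case: (ltngtP x0 y0) => // xy _; [exists x0, y0 | exists y0, x0];
    by split=> //; rewrite -ltnS.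
have Mup l : j <= l <= n -> M l.
  elim: l => [|l IH]; first by rewrite leqn0 => /andP[/eqP <-].
  case: (ltngtP j l.+1) => // [jl /= ln|<- //].
  by apply: (up i) => //; [apply: IH | ]; lia.
have Mn : M n by apply: Mup; lia.
have [n1 En1] : exists n1, n = n1.+1 by exists n.-1; lia.
have turn' : c n./2 = ~~ c n1./2.
  have -> : n1./2 = n./2.-1 by lia.
  by move: turn; case: (c _); case: (c _).
have [Mn1|notMn1] := pselect (M n1).
  have low y : y.+1 < n1 -> M y.
    move=> yn; apply: contrapT => notMy.
    have [+ _] := sees y n1 n ltac:(lia) notMy Mn1 Mn.
    have [-> _] := pin_order_far c tt yn.
    have [-> _] := @pin_order_far c tt y n ltac:(lia).
    by rewrite turn'; case: (c _).
  have Mn2 : M n1.-1.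
    by have := @up 0 n1.-2; rewrite prednK; last lia;
      apply; [apply: low; lia | apply: low; lia | lia | lia].
  move=> kn; have [klow|] := ltnP k.+1 n1; first exact: low.
  rewrite leq_eqVlt => /predU1P[kE|]; first by move: Mn2; rewrite kE.
  by case: (ltngtP k n1) => // [? ?|? _|-> //]; [lia|have -> : k = n by lia].
exfalso.
have iE : i.+1 < n1.
  have [//||iE] := ltngtP i.+1 n1.
    move=> n1i; have iE : i = n1 by lia.
    by case: notMn1; rewrite -iE.
  have [+ +] := sees n1 i n ltac:(lia) notMn1 Mi Mn.
  have [+ +] := pin_order_next c tt i; rewrite iE => -> ->.
  have [+ +] := pin_order_next c tt n1; rewrite -En1 => -> ->.
  have -> : odd n1 by lia.
  by rewrite n_even /= turn'; case: (c _).
(* By [up], a member between [i] and [n - 1] would force [n - 1] in. *)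
have notM l : i < l <= n1 -> ~ M l.
  move=> /andP[il ln] Ml; apply: notMn1.
  suff Ml' d : l + d <= n1 -> M (l + d) by have := Ml' (n1 - l); rewrite subnKC //; apply.
  elim: d => [|d IH] ld; first by rewrite addn0.
  by rewrite addnS; apply: (up i) => //; [apply: IH|..]; lia.
have [n2 En2] : exists n2, n1 = n2.+1 by exists n1.-1; lia.
have n2E : n2./2 = n1./2 by lia.
(* The point [n - 2] leaves [i = n - 3] as the only possibility. *)
have iE2 : i.+1 = n2.
  case: (ltngtP i.+1 n2) => [in2|?|//]; last by lia.
  have [+ +] := sees n2 i n ltac:(lia) (notM n2 ltac:(lia)) Mi Mn.
  have [-> ->] := pin_order_far c tt in2.
  have [-> ->] := @pin_order_far c tt n2 n ltac:(lia).
  by rewrite turn' n2E; case: (c _).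
(* The points [i - 1] and [i - 2] have the same relation to [n], but [i]
   separates them. *)
have [a aE] : exists a, i = a.+2 by exists i.-2; lia.
have notMa d : a <= d < i -> ~ M d.
  move=> /andP[ad di] Md; apply: (notM i.+1); first by lia.
  by apply: (up d) => //; lia.
have [+ _] := sees a.+1 i n ltac:(lia) (notMa a.+1 ltac:(lia)) Mi Mn.
have [+ _] := sees a i n ltac:(lia) (notMa a ltac:(lia)) Mi Mn.
have [-> _] := @pin_order_far c tt a n ltac:(lia).
have [-> _] := @pin_order_far c tt a.+1 n ltac:(lia).
have [-> _] := @pin_order_far c tt a i ltac:(lia).
have [] := pin_order_next c tt a.+1; rewrite -aE => -> _ ->.
have -> : odd i by lia.
by case: (c _).
Qed.

(** * Embeddings between pin orders *)

Definition syndetic_letters c := forall q b, exists2 k, q <= k < q + 4 & c k = b.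

(** [g] is an embedding of the interval [[0, n]] of [pin_order c] in
    [pin_order c'], whose image has the shape given by [prime_interval]. *)
Section Rigidity.
Variables (c c' : nat -> bool) (n e : nat) (g : nat -> nat).
Hypothesis g_inj : forall i j, i <= n -> j <= n -> g i = g j -> i = j.
Hypothesis g_rel : forall i j, i <= n -> j <= n ->
  pin_order c' tt (g i) (g j) = pin_order c tt i j.
Hypothesis g_le : forall x, x <= n -> g x <= e.
Hypothesis g_onto : forall i, i < n -> exists2 x, x <= n & g x + i = e.

(** The points whose image is below [g x] form a module once [x] is removed.  In
    the domain, such a module with two points has a maximum [x'] equal to [n] or
    followed by the removed point, because [x' + 1] splits it; and [n] is
    excluded by [g x <= g n]. *)
Lemma max_below x z1 z2 : x <= n -> g x <= g n -> z1 <= n -> z2 <= n ->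
  z1 <> z2 -> g z1 < g x -> g z2 < g x ->
  exists x', [/\ x = x'.+1, g x' < g x &
    forall z, z <= n -> g z < g x -> z <= x'].
Proof.
move=> xn gxn z1n z2n z12 gz1 gz2.
have exP : exists z, (z <= n) && (g z < g x) by exists z1; rewrite z1n.
have leP z : (z <= n) && (g z < g x) -> z <= n by case/andP.
case: (ex_maxnP exP leP) => m /andP[mn gm] m_max.
have below z : z <= n -> g z < g x -> z <= m by move=> zn gz; apply: m_max; rewrite zn.
exists m; split=> //; apply: contrapT => xm.
have lt_mn : m < n.
  by rewrite ltn_neqAle mn andbT; apply/eqP => mE; move: gm; rewrite mE; lia.
have gm1 : g x < g m.+1.
  have := below _ lt_mn; have : g x <> g m.+1 by move=> /g_inj - /(_ xn lt_mn).
  by lia.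
have [z [zm zn gz]] : exists z, [/\ z < m, z <= n & g z < g x].
  have [z1m|] := ltnP z1 m; first by exists z1.
  by exists z2; split=> //; have := below _ z1n gz1; have := below _ z2n gz2; lia.
apply: (pin_splits (c := c) (u := tt) zm).
have [] := @uniform_below_pin_order c' tt (g z) (g m) (g m.+1) ltac:(lia) ltac:(lia).
by rewrite !g_rel.
Qed.

(** Comparing [max_below] at [x] and at [u] shows that the maximum of the points
    mapped below [g x] is [u].  The points [v] and [w] provide the two points
    required in both applications. *)
Lemma pred_step x u v w : x <= n -> u <= n -> v <= n -> w <= n ->
  g x <= g n -> (g u).+1 = g x -> (g v).+1 = g u -> (g w).+1 = g v ->
  x = u.+1.
Proof.
move=> xn un vn wn gxn gu gv gw.
have uv : u <> v by move=> uv; move: gv; rewrite uv; lia.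
have vw : v <> w by move=> vw; move: gw; rewrite vw; lia.
have [x' [xE gx' x'_max]] := max_below xn gxn un vn uv ltac:(lia) ltac:(lia).
have [u' [uE gu' u'_max]] :=
  @max_below u v w un ltac:(lia) vn wn vw ltac:(lia) ltac:(lia).
have ux' := x'_max u un ltac:(lia).
have [gux'|gux'] := ltnP (g x') (g u).
  by have := u'_max x' ltac:(lia) gux'; lia.
by have := @g_inj x' u ltac:(lia) un ltac:(lia); lia.
Qed.

(** The point [n] is incomparable to or above all but its predecessor, so its
    image is never below a point of the image other than that of [n - 1].  But
    points of the target with letter [true] are above all remote earlier points,
    and two of them occur among the last few points of the image. *)
Lemma image_top : syndetic_letters c' -> 16 <= n -> e < g n + 10.
Proof.
move=> bal n_large; rewrite ltnNge; apply/negP => far.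
have [k kq ck] := bal (e - 7)./2 true.
have onto w : e - 8 <= w <= e -> exists2 x, x <= n & g x = w.
  by move=> we; have [x xn gx] := g_onto (i := e - w) ltac:(lia); exists x; lia.
have [x0 x0n gx0] := onto k.*2 ltac:(lia).
have [x1 x1n gx1] := onto k.*2.+1 ltac:(lia).
have [x [xn gxk gx]] : exists x, [/\ x.+1 < n, (g x)./2 = k & (g n).+1 < g x].
  have x01 : x0 <> x1 by move=> x01; move: gx1; rewrite -x01; lia.
  have x0N : x0 <> n by move=> x0N; move: gx0; rewrite x0N; lia.
  have x1N : x1 <> n by move=> x1N; move: gx1; rewrite x1N; lia.
  by have [x0n1|x0n1] := ltnP x0.+1 n; [exists x0|exists x1]; split; lia.
have [_ +] := pin_order_far c tt xn.
by have [+ _] := pin_order_far c' tt gx; rewrite g_rel //; [rewrite gxk ck => -> | lia].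
Qed.

(** Repeated use of [pred_step] downwards from [n]. *)
Lemma image_shift : syndetic_letters c' -> 16 <= n ->
  forall i, i + 13 <= n -> g (n - i) + i = g n.
Proof.
move=> bal n_large; have top := image_top bal n_large.
have gn := g_le (leqnn n).
elim=> [|i IH] i_le; first by rewrite subn0 addn0.
have gi := IH ltac:(lia).
have [u un gu] := @g_onto (e - g n + i.+1) ltac:(lia).
have [v vn gv] := @g_onto (e - g n + i.+2) ltac:(lia).
have [w wn gw] := @g_onto (e - g n + i.+3) ltac:(lia).
have uE := @pred_step (n - i) u v w ltac:(lia) un vn wn ltac:(lia) ltac:(lia) ltac:(lia) ltac:(lia).
have -> : n - i.+1 = u by lia.
by lia.
Qed.

(** The translation is even because an adjacent pair with letter [false] is
    increasing exactly when its greater index is odd; the letter at [2k] is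
    then read off from the relation of [2k] to the remote point 13. *)
Lemma word_shift : syndetic_letters c -> syndetic_letters c' -> 40 <= n -> ~~ odd n ->
  n <= g n + 9 /\
  forall k, 16 <= k.*2 <= n -> c k = c' (k + (g n)./2 - n./2).
Proof.
move=> bal bal' n_large n_even.
have shift j : 13 <= j <= n -> g j + n = g n + j.
  move=> j_int; have := @image_shift bal' ltac:(lia) (n - j) ltac:(lia).
  rewrite subKn; last by lia.
  by lia.
have en : n <= e.
  (* The [n + 1] distinct values of [g] are at most [e]. *)
  have n_inj : {in iota 0 n.+1 &, injective g}.
    by move=> i j; rewrite !mem_iota => i_n j_n; apply: g_inj; lia.
  have := @uniq_leq_size _ (map g (iota 0 n.+1)) (iota 0 e.+1).
  rewrite map_inj_in_uniq // iota_uniq size_map !size_iota ltnS; apply=> //.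
  by move=> _ /mapP[x + ->]; rewrite !mem_iota => x_n; have := @g_le x ltac:(lia); lia.
have top := image_top bal' ltac:(lia).
have gn_even : ~~ odd (g n).
  have [k k_int ck] := bal 7 false.
  have [+ _] := pin_order_next c tt k.*2; rewrite -g_rel ?ltnS; [|lia|lia].
  have -> : g k.*2.+1 = (g k.*2).+1.
    by have := shift k.*2 ltac:(lia); have := shift k.*2.+1 ltac:(lia); lia.
  have [-> _] := pin_order_next c' tt (g k.*2).
  have -> : (k.*2.+1)./2 = k by lia.
  rewrite ck /= odd_double /= => /andP[g_even _].
  by have := shift k.*2 ltac:(lia); lia.
split=> [|k k_int]; first by lia.
have gk := shift k.*2 ltac:(lia); have g13 := shift 13 ltac:(lia).
have [+ _] := @pin_order_far c tt 13 k.*2 ltac:(lia).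
have [+ _] := @pin_order_far c' tt (g 13) (g k.*2) ltac:(lia).
rewrite g_rel; [|lia|lia] => -> .
have -> : k.*2./2 = k by lia.
have -> // : (g k.*2)./2 = k + (g n)./2 - n./2 by lia.
Qed.

End Rigidity.

End PinSequences.

(** * Ruler words *)

Section RulerWords.
Implicit Types a b : nat -> bool.

(** The letters of valuations [2i] and [2i + 1] are opposite, so that the
    sequence of letters is never constant three times in a row; the bits of [a]
    are the letters of even valuation. *)
Definition ruler_letter a v := a v./2 (+) odd v.
Definition ruler_word a k := ruler_letter a (logn 2 k.+1).

Lemma logn2_mul v r : odd r -> logn 2 (2 ^ v * r) = v.
Proof.
move=> odd_r; have r_gt0 := odd_gt0 odd_r.
rewrite lognM ?expn_gt0 // pfactorK //.
by rewrite logn_coprime ?coprime2n // addn0.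
Qed.

Lemma logn2_decomp k : 0 < k -> exists2 r, odd r & k = 2 ^ logn 2 k * r.
Proof.
move=> k_gt0; have [r r2 kE] := @pfactor_coprime 2 k isT k_gt0.
by exists r; rewrite ?coprime2n // in r2 *; rewrite mulnC.
Qed.

Lemma logn2_add V q k : 0 < k < 2 ^ V -> logn 2 (2 ^ V * q + k) = logn 2 k.
Proof.
move=> /andP[k_gt0 kV]; have [r odd_r kE] := logn2_decomp k_gt0.
have vV : logn 2 k < V.
  rewrite -(@ltn_exp2l 2) //; apply: leq_ltn_trans kV.
  by rewrite {2}kE leq_pmulr // odd_gt0.
have -> : 2 ^ V * q + k = 2 ^ logn 2 k * (2 ^ (V - logn 2 k) * q + r).
  by rewrite mulnDr -kE mulnA -expnD subnKC // ltnW.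
by rewrite logn2_mul // oddD oddM oddX subn_eq0 leqNgt vV.
Qed.

Lemma ruler_word_even a k : ~~ odd k -> ruler_word a k = a 0.
Proof.
move=> k_even; rewrite /ruler_word -[k.+1]mul1n (@logn2_mul 0) //.
by rewrite /ruler_letter /= addbF.
Qed.

Lemma ruler_word_1mod4 a r : ruler_word a (4 * r).+1 = ~~ a 0.
Proof.
rewrite /ruler_word; have -> : (4 * r).+2 = 2 ^ 1 * (2 * r).+1 by lia.
by rewrite logn2_mul /ruler_letter /= ?addbT // oddM.
Qed.

Lemma syndetic_letters_ruler_word a : syndetic_letters (ruler_word a).
Proof.
move=> q b; have [<-|ab] := eqVneq (a 0) b.
  by exists (q + odd q); [lia | rewrite ruler_word_even //; lia].
exists (4 * ((q + 2) %/ 4)).+1; first by lia.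
by rewrite ruler_word_1mod4; move: ab; case: (a 0); case: b.
Qed.

Lemma ruler_word_period a V q k : k.+1 < 2 ^ V ->
  ruler_word a (2 ^ V * q + k) = ruler_word a k.
Proof. by move=> kV; rewrite /ruler_word -addnS logn2_add. Qed.

Lemma recurrent_pins_ruler a : recurrent (pins (ruler_word a)).
Proof.
move=> m; exists (2 ^ m.+2) => p; exists (2 ^ m.+2 * (p %/ 2 ^ m.+2).+1).
  rewrite mulnS addnC; have := divn_eq p (2 ^ m.+2).
  by have := @ltn_pmod p (2 ^ m.+2); rewrite expn_gt0 mulnC => /(_ isT); lia.
move=> i x y xm ym; apply: pins_shift; first by rewrite oddM expnS oddM.
all: set t := (p %/ _).+1; rewrite expnS -mulnA mul2n.
all: have m2 := @ltn_expl 2 m.+1 isT.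
- have -> : ((2 ^ m.+1 * t).*2 + x)./2 = 2 ^ m.+1 * t + x./2 by lia.
  by apply: ruler_word_period; lia.
- have -> : ((2 ^ m.+1 * t).*2 + y)./2 = 2 ^ m.+1 * t + y./2 by lia.
  by apply: ruler_word_period; lia.
Qed.

Lemma ruler_letter_not_constant a v :
  ~ (ruler_letter a v.+1 = ruler_letter a v.+2 /\
     ruler_letter a v.+2 = ruler_letter a v.+3).
Proof.
rewrite /ruler_letter /= uphalf_half; case: (odd v) => /=.
  by case: (a _); case: (a _) => -[].
by rewrite add0n; case: (a _); case: (a _) => -[].
Qed.

(** Let a long prefix of the word of [a] occur at position [s] in the word of
    [b].  If [s] is divisible by [2 ^ (v + 1)], the valuations up to [v] agree
    at [2 ^ v] and [2 ^ v + s], and the letters at valuation [v] are equal.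
    Otherwise [s] has a valuation [e <= v], and the numbers [2 ^ (e + d)] with
    [0 < d] all become of valuation [e] after adding [s], which would make three
    consecutive letters of [a] equal. *)
Lemma ruler_word_inj a b :
  (forall V, exists s, forall k, k.+1 < 2 ^ V ->
     ruler_word a k = ruler_word b (k + s)) ->
  a = b.
Proof.
move=> factor.
suff letterE v : ruler_letter a v = ruler_letter b v.
  apply/funext => v; have := letterE v.*2.
  by rewrite /ruler_letter odd_double doubleK !addbF.
have [s sP] := factor (v + 5).
have factorE k : 0 < k < 2 ^ (v + 5) ->
    ruler_letter a (logn 2 k) = ruler_letter b (logn 2 (k + s)).
  by case: k => // k /andP[_ kV]; exact: sP.
have [/dvdnP[q sE]|ndvd] := boolP (2 ^ v.+1 %| s).
  have vV : 0 < 2 ^ v < 2 ^ (v + 5) by rewrite expn_gt0 ltn_exp2l //=; lia.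
  have := factorE _ vV; rewrite pfactorK // => ->.
  have -> : 2 ^ v + s = 2 ^ v * (2 * q).+1 by rewrite sE expnS; lia.
  by rewrite logn2_mul //= oddM.
have s_gt0 : 0 < s by case: s ndvd {sP factorE}; rewrite ?dvdn0.
have [r odd_r sE] := logn2_decomp s_gt0.
set e := logn 2 s in sE.
have ev : e <= v.
  rewrite leqNgt; apply: contra ndvd => ve.
  by rewrite sE dvdn_mulr // dvdn_exp2l.
have same d : d < 3 -> ruler_letter a (e + d.+1) = ruler_letter b e.
  move=> d3; have dV : 0 < 2 ^ (e + d.+1) < 2 ^ (v + 5).
    by rewrite expn_gt0 ltn_exp2l //=; lia.
  have := factorE _ dV; rewrite pfactorK // => ->.
  have -> : 2 ^ (e + d.+1) + s = 2 ^ e * (2 ^ d.+1 + r).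
    by rewrite mulnDr -expnD -sE.
  by rewrite logn2_mul // oddD oddX.
have := same 0 isT; have := same 1 isT; have := same 2 isT.
rewrite addn3 addn2 addn1 => e3 e2 e1.
by have [] := @ruler_letter_not_constant a e; rewrite e1 e2 e3.
Qed.

End RulerWords.

(** * Continuum many minimal prime ages *)

Lemma prime_initials a N :
  exists2 n, N <= n & prime_structure (initial (pin_order (ruler_word a)) n).
Proof.
exists (8 * N.+1 + 3); first by lia.
rewrite addnS; apply: initial_pin_order_prime; [lia|lia|].
have -> : (8 * N.+1 + 2)./2 = (4 * N.+1).+1 by lia.
rewrite ruler_word_1mod4 ruler_word_even; last by rewrite oddM.
by case: (a 0).
Qed.

Lemma minimal_prime_pins a : minimal_prime (age (pins (ruler_word a))).
Proof.
apply: minimal_prime_age => [||N].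
- exact: uniform_below_pins.
- exact: recurrent_pins_ruler.
- have [n Nn primeP] := prime_initials a N.
  by exists n => //; apply: prime_of_intersection primeP.
Qed.

Lemma minimal_prime_pin_order a : minimal_prime (age (pin_order (ruler_word a))).
Proof.
apply: minimal_prime_age => [|m|].
- exact: uniform_below_pin_order.
- have [L recL] := recurrent_pins_ruler a m.
  exists L => p; have [s s_int s_rel] := recL p.
  by exists s => // u x y xm ym; rewrite /pin_order /intersection_order !s_rel.
- exact: prime_initials.
Qed.

(** The interval of length about [8 * 2 ^ V] is prime and long enough for the
    factor of [a] at positions [2 ^ V, ..., 2 ^ V + 2 ^ V - 2], which repeats the
    prefix, to lie in the part where the embedding is a translation. *)
Lemma pin_order_factor a b :
  age (pin_order (ruler_word a)) `<=` age (pin_order (ruler_word b)) ->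
  forall V, exists s, forall k, k.+1 < 2 ^ V ->
    ruler_word a k = ruler_word b (k + s).
Proof.
move=> sub_age V.
(* The unknown points at the lower end, and a possible translation by a few
   steps to the left, must be absorbed by [2 ^ V]. *)
wlog V_large : V / 5 <= V.
  move=> large; have [s sP] := large (V + 5) (leq_addl _ _).
  by exists s => k kV; apply: sP; apply: leq_trans kV _; rewrite leq_exp2l // leq_addr.
have P_large : 32 <= 2 ^ V by rewrite (@leq_exp2l 2 5).
set P := 2 ^ V in P_large *.
pose n := 8 * P + 2.
have primeS : prime_structure (initial (pin_order (ruler_word a)) n.+1).
  apply: initial_pin_order_prime; rewrite /n; [lia|lia|].
  have -> : (8 * P + 2)./2 = (4 * P).+1 by lia.
  rewrite ruler_word_1mod4 ruler_word_even; last by rewrite oddM.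
  by case: (a 0).
have /embedsP[f emb] := sub_age _ (age_initial _ n.+1).
have [f_inj f_rel] := emb.
have [e f_le f_top] := exists_max f.
pose g i := f (inord i).
have g_inj i j : i <= n -> j <= n -> g i = g j -> i = j.
  by move=> i_n j_n /f_inj/(congr1 val); rewrite /= !inordK.
have g_rel i j : i <= n -> j <= n ->
    pin_order (ruler_word b) tt (g i) (g j) = pin_order (ruler_word a) tt i j.
  by move=> i_n j_n; rewrite f_rel /= !inordK.
have g_onto i : i < n -> exists2 x, x <= n & g x + i = e.
  move=> i_n; have [x fx] := prime_interval (@uniform_below_pin_order _) emb primeS f_le f_top (i := i) i_n.
  by exists x; rewrite ?leq_ord // /g inord_val.
have [||gn shift] := word_shift g_inj g_rel (fun x _ => f_le _) g_onto
  (syndetic_letters_ruler_word a) (syndetic_letters_ruler_word b).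
- by rewrite /n; lia.
- by rewrite /n; lia.
exists (P + (g n)./2 - n./2) => k kP.
rewrite -(@ruler_word_period a V 1) // muln1 -/P shift; last by rewrite /n; lia.
have nE : n = 8 * P + 2 by [].
by congr ruler_word; lia.
Qed.

Lemma age_pin_order_inj : injective (fun a => age (pin_order (ruler_word a))).
Proof.
move=> a b ab; apply/ruler_word_inj/pin_order_factor.
by rewrite (ab : age (pin_order (ruler_word a)) = _).
Qed.

Lemma age_pins_inj : injective (fun a => age (pins (ruler_word a))).
Proof.
move=> a b ab; apply/ruler_word_inj/pin_order_factor/age_intersection_order.
by rewrite (ab : age (pins (ruler_word a)) = _).
Qed.

Lemma card_continuum (I : finType) (A : set (set (fin_structure I)))
    (F : (nat -> bool) -> set (fin_structure I)) :
  injective F -> (forall a, A (F a)) -> A #= [set: nat -> bool].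
Proof.
move=> F_inj F_in; rewrite card_eq_le; apply/andP; split.
  exact: card_le_trans (subset_card_le (@subsetT _ A)) (card_fin_classes_le I).
have := @inj_card_eq _ _ [set: nat -> bool] F (fun _ _ _ _ => @F_inj _ _).
rewrite card_eq_le => /andP[_ ge].
apply: card_le_trans ge (subset_card_le _).
by move=> _ [a _ <-].
Qed.

Theorem theorem22 :
  ([set C | bichain_ages C /\ minimal_prime C] #= [set: nat -> bool]) /\
  ([set C | permutation_order_ages C /\ minimal_prime C] #= [set: nat -> bool]).
Proof.
split.
- apply: (card_continuum age_pins_inj) => a.
  split; last exact: minimal_prime_pins.
  by exists nat, (pins (ruler_word a)); split=> //; exact: bichain_pins.
- apply: (card_continuum age_pin_order_inj) => a.
  split; last exact: minimal_prime_pin_order.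
  exists nat, (pin_order (ruler_word a)).
  by split=> //; exact: permutation_order_pin_order.
Qed.
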